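(* Let $\mathcal V$ be the category of normed (resp. seminormed) vector spaces over $R=\mathbb R$ or $\mathbb C$ with nonexpansive linear maps. The category $\mathbf{Ban}_1$ of Banach spaces is the $\mathcal V$-reflective-hull of $R$ in $\underline{\mathcal V}$. Moreover, a normed (resp. seminormed) vector space $B$ is a Banach space if and only if the following equivalent conditions hold for each morphism $h:V\to W$ in $\mathcal V$: (1) If $h\bot_{\mathcal V}R$, then $h\bot_{\mathcal V}B$. (2) If $h^*:W^*\to V^*$ is an isomorphism in $\mathcal V$, then $\underline{\mathcal V}(h,B):\underline{\mathcal V}(W,B)\to\underline{\mathcal V}(V,B)$ is an isomorphism in $\mathcal V$.
   Context: $\mathcal V$ is either $\mathbf{Norm}_1$ or $\mathbf{SNorm}_1$: normed, resp. seminormed, vector spaces over $R=\mathbb R$ or $\mathbb C$, with linear maps that are nonexpansive ($\|f(v)\|\le\|v\|$). $\mathcal V$ is symmetric monoidal closed: the internal hom $\underline{\mathcal V}(V,W)$ is the space of all bounded linear maps $V\to W$ with the operator (semi)norm, and the monoidal product is the algebraic tensor product with the projective (semi)norm. $\underline{\mathcal V}$ is $\mathcal V$ viewed as a $\mathcal V$-category. The dual is $V^*=\underline{\mathcal V}(V,R)$, and $h^*=\underline{\mathcal V}(h,R)$. Isomorphisms in $\mathcal V$ are the isometric linear bijections. $\mathbf{Ban}_1$ is the full subcategory of $\mathcal V$ of Banach spaces (normed and Cauchy-complete). For $h:V\to W$ in $\mathcal V$ and an object $B$, $h\bot_{\mathcal V}B$ means that $\underline{\mathcal V}(h,B):\underline{\mathcal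 V}(W,B)\to\underline{\mathcal V}(V,B)$ is an isomorphism in $\mathcal V$. A $\mathcal V$-reflective-subcategory of a $\mathcal V$-category $\mathcal B$ is a full replete sub-$\mathcal V$-category whose inclusion has a left $\mathcal V$-adjoint. The $\mathcal V$-reflective-hull of a full sub-$\mathcal V$-category (here the one with single object $R$) is the smallest $\mathcal V$-reflective-subcategory of $\mathcal B$ containing it. *)

(* Defs.v *)
From HB Require Import structures.
From mathcomp Require Import all_boot all_order all_algebra.
From mathcomp Require Import boolp classical_sets functions reals.
From mathcomp Require Import complex.

Set Implicit Arguments.
Unset Strict Implicit.
Unset Printing Implicit Defensive.

Import Order.TTheory GRing.Theory Num.Theory.
Local Open Scope classical_set_scope.
Local Open Scope ring_scope.

Variant scalar_kind := RealScalars | ComplexScalars.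

Variant flavour := Norm1 | SNorm1.

Definition scalar_field (R : realType) (k : scalar_kind) : numFieldType :=
  match k with RealScalars => R | ComplexScalars => R[i] end.

(* The norm of the library on R[i] takes its values in R[i]; here every norm,
   including the modulus of a scalar, takes its values in R. *)
Definition modulus (R : realType) (k : scalar_kind) : scalar_field R k -> R :=
  match k with
  | RealScalars => fun x : R => `|x|
  | ComplexScalars => fun z : R[i] => Normc.normc z
  end.

Section Modulus.
Context (R : realType) (k : scalar_kind).
Implicit Types a b : scalar_field R k.

Lemma modulusD a b : modulus (a + b) <= modulus a + modulus b.
Proof. by case: k a b => a b; [exact: ler_normD | exact: le_normcD]. Qed.

Lemma modulusM a b : modulus (a * b) = modulus a * modulus b.
Proof. by case: k a b => a b; [exact: normrM | exact: Normc.normcM]. Qed.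

Lemma modulus_Mn a n : modulus (a *+ n) = modulus a *+ n.
Proof. by case: k a => a; [exact: normrMn | exact: normcMn]. Qed.

Lemma modulusN a : modulus (- a) = modulus a.
Proof. by case: k a => a; [exact: normrN | exact: normcN]. Qed.

Lemma modulus0_eq0 a : modulus a = 0 -> a = 0.
Proof. by case: k a => a; [exact: normr0_eq0 | exact: Normc.eq0_normc]. Qed.

Lemma modulus1 : modulus (1 : scalar_field R k) = 1.
Proof. by case: k; [exact: normr1 | exact: Normc.normc1]. Qed.

Lemma modulus0 : modulus (0 : scalar_field R k) = 0.
Proof. by case: k; [exact: normr0 | exact: Normc.normc0]. Qed.

Lemma modulus_ge0 a : 0 <= modulus a.
Proof. by case: k a => [a|[a b]]; [exact: normr_ge0 | exact: sqrtr_ge0]. Qed.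

End Modulus.

HB.mixin Record isSemiNormedModule (R : realType) (k : scalar_kind) V
    & Num.SemiNormedZmodule R V & GRing.Lmodule (scalar_field R k) V := {
  snormrZ : forall (a : scalar_field R k) (v : V), `|a *: v| = modulus a * `|v| :> R
}.

#[short(type="semiNormedModType")]
HB.structure Definition SemiNormedModule (R : realType) (k : scalar_kind) :=
  { V of Num.SemiNormedZmodule R V & GRing.Lmodule (scalar_field R k) V
       & isSemiNormedModule R k V }.

Definition norm_definite (R : realType) (k : scalar_kind)
    (V : semiNormedModType R k) : Prop :=
  forall v : V, `|v| = 0 :> R -> v = 0.

Section Unit.
Context (R : realType) (k : scalar_kind).

(* A copy of the scalar field, kept apart from (scalar_field R k)^o, whose norm in the
   library is valued in the scalar field. *)
Definition scalar_space : Type := scalar_field R k.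

HB.instance Definition _ :=
  GRing.Lmodule.copy scalar_space (GRing.regular (scalar_field R k)).

Definition scalar_norm (a : scalar_space) : R := @modulus R k a.

HB.instance Definition _ := @Num.Zmodule_isSemiNormed.Build R scalar_space
  scalar_norm (@modulusD R k) (@modulus_Mn R k) (@modulusN R k).

HB.instance Definition _ := @isSemiNormedModule.Build R k scalar_space
  (@modulusM R k).

Lemma scalar_definite : norm_definite scalar_space.
Proof. exact: modulus0_eq0. Qed.

End Unit.

Section BoundedLinear.
Context (R : realType) (k : scalar_kind) (V W : semiNormedModType R k).

Definition bounded_linear : {pred V -> W} := fun f =>
  `[< linear f /\ exists M : R, forall v, `|f v| <= M * `|v| :> R >].

Record bhom := BHom {
  bhom_fun :> V -> W;
  bhomP : bhom_fun \in bounded_linear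
}.

HB.instance Definition _ := [isSub for bhom_fun].
HB.instance Definition _ := [Choice of bhom by <:].

Lemma bounded_linear_submod_closed : submod_closed bounded_linear.
Proof.
split=> [|a f g /asboolP[fl [M fM]] /asboolP[gl [N gN]]]; apply/asboolP; split.
- by move=> a u v; rewrite /= scaler0 addr0.
- by exists 0 => v; rewrite normr0 mul0r.
- move=> b u v; rewrite /= !fctE fl gl !scalerDr !scalerA (mulrC a b).
  by rewrite addrACA.
- exists (modulus a * M + N) => v; rewrite /= !fctE mulrDl.
  apply: le_trans (ler_normD _ _) _; apply: lerD => //.
  by rewrite snormrZ -mulrA ler_wpM2l ?modulus_ge0.
Qed.

HB.instance Definition _ :=
  GRing.isSubmodClosed.Build _ _ bounded_linear bounded_linear_submod_closed.
HB.instance Definition _ := [SubChoice_isSubLmodule of bhom by <:].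

Lemma bhom_linear (f : bhom) : linear f.
Proof. by have /asboolP[] := bhomP f. Qed.

Lemma bhom_bounded (f : bhom) : exists M : R, forall v, `|f v| <= M * `|v| :> R.
Proof. by have /asboolP[] := bhomP f. Qed.

HB.instance Definition _ (f : bhom) :=
  GRing.isLinear.Build (scalar_field R k) V W *:%R f (@bhom_linear f).

Lemma bhom_ext (f g : bhom) : f =1 g -> f = g.
Proof. by move=> fg; apply/val_inj/funext. Qed.

Lemma bhom_DE (f g : bhom) v : (f + g) v = f v + g v. Proof. by []. Qed.
Lemma bhom_NE (f : bhom) v : (- f) v = - f v. Proof. by []. Qed.
Lemma bhom_ZE a (f : bhom) v : (a *: f) v = a *: f v. Proof. by []. Qed.
Lemma bhom_0E v : (0 : bhom) v = 0. Proof. by []. Qed.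

Definition opnorm (f : bhom) : R :=
  sup [set (`|f v| : R) | v in [set v : V | `|v| <= 1 :> R]].

Lemma opnorm_has_sup (f : bhom) :
  has_sup [set (`|f v| : R) | v in [set v : V | `|v| <= 1 :> R]].
Proof.
split; first by exists `|f 0|, 0 => //=; rewrite normr0.
have [M fM] := bhom_bounded f.
exists `|M| => _ [v /= v1 <-]; apply: le_trans (fM v) _.
apply: le_trans (_ : `|M| * `|v| <= _); last by rewrite ler_piMr.
by rewrite ler_wpM2r ?ler_norm.
Qed.

Lemma opnorm_ge0 (f : bhom) : 0 <= opnorm f.
Proof.
apply: le_trans (normr_ge0 (f 0)) _; apply: sup_upper_bound.
  exact: opnorm_has_sup.
by exists 0 => //=; rewrite normr0.
Qed.

Lemma opnorm_le (f : bhom) (M : R) : 0 <= M ->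
  (forall v, `|f v| <= M * `|v| :> R) -> opnorm f <= M.
Proof.
move=> M0 fM; apply: sup_le_ub; first by have [] := opnorm_has_sup f.
move=> _ [v /= v1 <-]; apply: le_trans (fM v) _; exact: ler_piMr.
Qed.

End BoundedLinear.

Section OpNorm.
Context (R : realType) (k : scalar_kind).

Lemma modulus_exists (r : R) : 0 <= r -> exists a : scalar_field R k, modulus a = r.
Proof.
case: k => r0; first by exists r; exact: ger0_norm.
by exists (r%:C)%C; rewrite /= expr0n addr0 sqrtr_sqr ger0_norm.
Qed.

Lemma opnormP (V W : semiNormedModType R k) (f : bhom V W) v :
  `|f v| <= opnorm f * `|v| :> R.
Proof.
have [v0|] := eqVneq (`|v| : R) 0.
  have [M /(_ v)] := bhom_bounded f.
  by rewrite v0 !mulr0.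
move=> vN0; have vp : 0 < `|v| :> R by rewrite lt_neqAle eq_sym vN0 normr_ge0.
have [a av] := @modulus_exists (`|v|^-1) (ltW (eq_ind_r is_true vp (invr_gt0 _))).
rewrite -ler_pdivrMr// mulrC -av -snormrZ -linearZ.
apply: sup_upper_bound; first exact: opnorm_has_sup.
by exists (a *: v) => //=; rewrite snormrZ av mulVf.
Qed.

Section Norm.
Context (V W : semiNormedModType R k).
Implicit Types f g : bhom V W.

Lemma opnormD f g : opnorm (f + g) <= opnorm f + opnorm g.
Proof.
apply: opnorm_le => [|v]; first by rewrite addr_ge0 ?opnorm_ge0.
rewrite bhom_DE mulrDl; apply: le_trans (ler_normD _ _) _.
by rewrite lerD ?opnormP.
Qed.

Lemma opnormZ_le a f : opnorm (a *: f) <= modulus a * opnorm f.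
Proof.
apply: opnorm_le => [|v]; first by rewrite mulr_ge0 ?modulus_ge0 ?opnorm_ge0.
by rewrite bhom_ZE snormrZ -mulrA ler_wpM2l ?modulus_ge0 ?opnormP.
Qed.

Lemma opnormZ a f : opnorm (a *: f) = modulus a * opnorm f.
Proof.
apply/eqP; rewrite eq_le opnormZ_le /=.
have [->|a0] := eqVneq a 0; first by rewrite modulus0 mul0r opnorm_ge0.
have {1}-> : f = a^-1 *: (a *: f) by rewrite scalerA mulVf ?scale1r.
apply: le_trans (_ : modulus a * (modulus a^-1 * opnorm (a *: f)) <= _).
  by rewrite ler_wpM2l ?modulus_ge0 ?opnormZ_le.
by rewrite mulrA -modulusM mulfV// modulus1 mul1r.
Qed.

Lemma opnormN f : opnorm (- f) = opnorm f.
Proof. by rewrite -scaleN1r opnormZ modulusN modulus1 mul1r. Qed.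

Lemma opnormMn f n : opnorm (f *+ n) = opnorm f *+ n.
Proof.
rewrite -scaler_nat opnormZ modulus_Mn modulus1.
by rewrite mulr_natl.
Qed.

HB.instance Definition _ := @Num.Zmodule_isSemiNormed.Build R (bhom V W)
  (@opnorm R k V W) opnormD opnormMn opnormN.

HB.instance Definition _ := @isSemiNormedModule.Build R k (bhom V W) opnormZ.

Lemma bhom_norm_def f : `|f| = opnorm f :> R. Proof. by []. Qed.

Lemma bhom_definite : norm_definite W -> norm_definite (bhom V W).
Proof.
move=> W0 f f0; apply: bhom_ext => v; apply: W0; apply/eqP.
rewrite eq_le normr_ge0 andbT; apply: le_trans (opnormP f v) _.
by rewrite -bhom_norm_def f0 mul0r.
Qed.

End Norm.
End OpNorm.

Section Category.
Context (R : realType) (k : scalar_kind) (fl : flavour).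

Record obj := Obj {
  space :> semiNormedModType R k;
  obj_definite : fl = Norm1 -> norm_definite space
}.

Record mor (V W : obj) := Mor {
  mor_fun :> {linear V -> W};
  mor_nonexpansive : forall v, `|mor_fun v| <= `|v| :> R
}.

Definition is_iso (V W : obj) (f : mor V W) : Prop :=
  exists g : mor W V, cancel f g /\ cancel g f.

Definition unit_obj : obj := Obj (fun=> @scalar_definite R k).

Definition ihom (V W : obj) : obj :=
  @Obj (bhom V W) (fun e => bhom_definite (obj_definite e)).

Definition app (V W : obj) (f : ihom V W) : V -> W := bhom_fun f.

Lemma linear_mor_subproof (V W : obj) (f : V -> W) :
  linear f -> (forall v, `|f v| <= `|v| :> R) -> f \in @bounded_linear R k V W.
Proof.
move=> f_lin f1; apply/asboolP.
split; first exact: f_lin.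
by exists 1 => v; rewrite mul1r f1.
Qed.

Definition bhom_of_mor (V W : obj) (f : mor V W) : ihom V W :=
  BHom (linear_mor_subproof (@linearP _ _ _ _ (mor_fun f)) (mor_nonexpansive f)).

Lemma bcomp_subproof (U V W : obj) (g : ihom V W) (f : ihom U V) :
  (app g \o app f) \in @bounded_linear R k U W.
Proof.
apply/asboolP; split=> [a u v /=|].
  by rewrite /app (@bhom_linear _ _ _ _ f) (@bhom_linear _ _ _ _ g).
exists (opnorm g * opnorm f) => v /=.
apply: le_trans (opnormP g _) _.
by rewrite -mulrA ler_wpM2l ?opnorm_ge0 ?opnormP.
Qed.

Definition bcomp (U V W : obj) (g : ihom V W) (f : ihom U V) : ihom U W :=
  BHom (bcomp_subproof g f).

Lemma bcomp_norm (U V W : obj) (g : ihom V W) (f : ihom U V) :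
  `|bcomp g f| <= `|g| * `|f| :> R.
Proof.
apply: opnorm_le => [|v]; first by apply: mulr_ge0; exact: normr_ge0.
rewrite -mulrA; apply: le_trans (opnormP g _) _.
by apply: ler_wpM2l; [exact: opnorm_ge0 | exact: opnormP].
Qed.

Lemma bcomp_linearl (U V W : obj) (f : ihom U V) :
  linear (fun g : ihom V W => bcomp g f).
Proof. by move=> a g h; apply: bhom_ext. Qed.

Lemma bcomp_linearr (U V W : obj) (g : ihom V W) :
  linear (fun f : ihom U V => bcomp g f).
Proof. by move=> a f h; apply: bhom_ext => v; exact: (@bhom_linear _ _ _ _ g). Qed.

Lemma postcomp_subproof (U V W : obj) (g : ihom V W) :
  (fun f : ihom U V => bcomp g f) \in
    @bounded_linear R k (ihom U V) (ihom U W).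
Proof.
apply/asboolP; split; first exact: bcomp_linearr.
by exists `|g| => f; exact: bcomp_norm.
Qed.

Definition postcomp (U V W : obj) (g : ihom V W) : ihom (ihom U V) (ihom U W) :=
  BHom (postcomp_subproof U g).

Lemma postcomp_linear (U V W : obj) : linear (@postcomp U V W).
Proof. by move=> a g h; apply: bhom_ext => f; exact: bcomp_linearl. Qed.

Lemma postcomp_nonexpansive (U V W : obj) (g : ihom V W) :
  `|postcomp U g| <= `|g| :> R.
Proof. by apply: opnorm_le => // f; exact: bcomp_norm. Qed.

HB.instance Definition _ (U V W : obj) :=
  GRing.isLinear.Build (scalar_field R k) (ihom V W) (ihom (ihom U V) (ihom U W))
    *:%R (@postcomp U V W) (@postcomp_linear U V W).

Definition comp_mor (U V W : obj) :
    mor (ihom V W) (ihom (ihom U V) (ihom U W)) :=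
  @Mor _ _ (@postcomp U V W) (@postcomp_nonexpansive U V W).

Lemma id_subproof (V : obj) : id \in @bounded_linear R k V V.
Proof. by apply: linear_mor_subproof. Qed.

Definition bid (V : obj) : ihom V V := BHom (id_subproof V).

Definition unit_to_id (V : obj) (a : unit_obj) : ihom V V :=
  (a : scalar_field R k) *: bid V.

Lemma unit_to_id_linear (V : obj) : linear (@unit_to_id V).
Proof. by move=> a b c; rewrite /unit_to_id scalerDl -scalerA. Qed.

HB.instance Definition _ (V : obj) :=
  GRing.isLinear.Build (scalar_field R k) unit_obj (ihom V V) *:%R (@unit_to_id V)
    (@unit_to_id_linear V).

Lemma unit_to_id_nonexpansive (V : obj) (a : unit_obj) :
  `|unit_to_id V a| <= `|a| :> R.
Proof.
by apply: opnorm_le => // v; rewrite /unit_to_id bhom_ZE snormrZ.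
Qed.

Definition id_mor (V : obj) : mor unit_obj (ihom V V) :=
  @Mor _ _ (@unit_to_id V) (@unit_to_id_nonexpansive V).

Section Precomposition.
Context (V W : obj) (h : mor V W) (B : obj).

Definition precomp_fun (g : ihom W B) : ihom V B := bcomp g (bhom_of_mor h).

Lemma precomp_linear : linear precomp_fun.
Proof. exact: bcomp_linearl. Qed.

HB.instance Definition _ :=
  GRing.isLinear.Build (scalar_field R k) (ihom W B) (ihom V B) *:%R precomp_fun
    precomp_linear.

Lemma precomp_nonexpansive (g : ihom W B) : `|precomp_fun g| <= `|g| :> R.
Proof.
apply: opnorm_le => // v; apply: le_trans (opnormP g _) _.
by rewrite ler_wpM2l ?opnorm_ge0 ?mor_nonexpansive.
Qed.

Definition precomp : mor (ihom W B) (ihom V B) :=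
  @Mor _ _ precomp_fun precomp_nonexpansive.

Definition vorthogonal : Prop := is_iso precomp.

End Precomposition.

Definition vdual (V : obj) : obj := ihom V unit_obj.

Definition vdual_mor (V W : obj) (h : mor V W) : mor (vdual W) (vdual V) :=
  precomp h unit_obj.

Definition cauchy_seq (V : obj) (u : nat -> V) : Prop :=
  forall e : R, 0 < e -> exists N : nat, forall m n : nat,
    (N <= m)%N -> (N <= n)%N -> `|u m - u n| < e.

Definition converges_to (V : obj) (u : nat -> V) (l : V) : Prop :=
  forall e : R, 0 < e -> exists N : nat, forall n : nat,
    (N <= n)%N -> `|u n - l| < e.

Definition banach (V : obj) : Prop :=
  norm_definite V /\
  forall u : nat -> V, cauchy_seq u -> exists l : V, converges_to u l.

(* Composition hom(b,c) (x) hom(a,b) -> hom(a,c) is given by its transpose under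
   the tensor-hom adjunction; morphisms out of the projective tensor product are
   exactly the bilinear maps with |g o f| <= |g| |f|. *)
Record vcat := VCat {
  vob :> Type;
  vhom : vob -> vob -> obj;
  vcomp : forall a b c, mor (vhom b c) (ihom (vhom a b) (vhom a c));
  vid : forall a, mor unit_obj (vhom a a);
  vcompA : forall a b c d (h : vhom c d) (g : vhom b c) (f : vhom a b),
    app (vcomp a b d (app (vcomp b c d h) g)) f =
    app (vcomp a c d h) (app (vcomp a b c g) f);
  vcomp1f : forall a b (f : vhom a b),
    app (vcomp a b b (vid b (1 : scalar_field R k))) f = f;
  vcompf1 : forall a b (f : vhom a b),
    app (vcomp a a b f) (vid a (1 : scalar_field R k)) = f
}.

Definition hcomp (C : vcat) (a b c : C) (g : vhom b c) (f : vhom a b) :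
  vhom a c := app (vcomp a b c g) f.

Definition hid (C : vcat) (a : C) : vhom a a := vid a (1 : scalar_field R k).

(* Isomorphism in the underlying ordinary category, whose morphisms a -> b are
   the morphisms from the unit object to vhom a b. *)
Definition visomorphic (C : vcat) (a b : C) : Prop :=
  exists (f : mor unit_obj (vhom a b)) (g : mor unit_obj (vhom b a)),
    hcomp (g (1 : scalar_field R k)) (f (1 : scalar_field R k)) = hid a /\
    hcomp (f (1 : scalar_field R k)) (g (1 : scalar_field R k)) = hid b.

Record vfunctor (C D : vcat) := VFunctor {
  vfob :> C -> D;
  vfmor : forall a b, mor (vhom a b) (vhom (vfob a) (vfob b));
  vfmor_comp : forall a b c (g : vhom b c) (f : vhom a b),
    vfmor a c (hcomp g f) = hcomp (vfmor b c g) (vfmor a b f);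
  vfmor_id : forall a, vfmor a a (hid a) = hid (vfob a)
}.

Definition left_vadjoint (C D : vcat) (F : vfunctor C D) (G : vfunctor D C) :
    Prop :=
  exists n : forall (c : C) (d : D), mor (vhom (F c) d) (vhom c (G d)),
    [/\ forall c d, is_iso (n c d),
        forall c d d' (g : vhom d d') (x : vhom (F c) d),
          n c d' (hcomp g x) = hcomp (vfmor G d d' g) (n c d x) &
        forall c c' d (f : vhom c' c) (x : vhom (F c) d),
          n c' d (hcomp x (vfmor F c' c f)) = hcomp (n c d x) f].

Definition full_subcat (C : vcat) (P : C -> Prop) : vcat :=
  @VCat {a : C | P a} (fun a b => vhom (sval a) (sval b))
    (fun a b c => vcomp (sval a) (sval b) (sval c))
    (fun a => vid (sval a))
    (fun a b c d => @vcompA C (sval a) (sval b) (sval c) (sval d))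
    (fun a b => @vcomp1f C (sval a) (sval b))
    (fun a b => @vcompf1 C (sval a) (sval b)).

Lemma idmor_nonexpansive (V : obj) (v : V) : `|idfun v| <= `|v| :> R.
Proof. by []. Qed.

Definition inclusion (C : vcat) (P : C -> Prop) : vfunctor (full_subcat P) C :=
  @VFunctor (full_subcat P) C sval
    (fun a b => @Mor _ _ idfun (@idmor_nonexpansive (vhom (sval a) (sval b))))
    (fun a b c g f => erefl) (fun a => erefl).

Definition replete (C : vcat) (P : C -> Prop) : Prop :=
  forall a b : C, visomorphic a b -> P a -> P b.

Definition vreflective (C : vcat) (P : C -> Prop) : Prop :=
  replete P /\ exists F : vfunctor C (full_subcat P), left_vadjoint F (inclusion P).

Definition is_vreflective_hull (C : vcat) (Q P : C -> Prop) : Prop :=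
  [/\ vreflective P, forall a, Q a -> P a &
      forall P' : C -> Prop, vreflective P' -> (forall a, Q a -> P' a) ->
        forall a, P a -> P' a].

Lemma self_compA (a b c d : obj) (h : ihom c d) (g : ihom b c) (f : ihom a b) :
  app (comp_mor a b d (app (comp_mor b c d h) g)) f =
  app (comp_mor a c d h) (app (comp_mor a b c g) f).
Proof. exact: bhom_ext. Qed.

Lemma self_comp1f (a b : obj) (f : ihom a b) :
  app (comp_mor a b b (id_mor b (1 : scalar_field R k))) f = f.
Proof. by apply: bhom_ext => v; exact: scale1r. Qed.

Lemma self_compf1 (a b : obj) (f : ihom a b) :
  app (comp_mor a a b f) (id_mor a (1 : scalar_field R k)) = f.
Proof. by apply: bhom_ext => v; congr (bhom_fun f _); exact: scale1r. Qed.

Definition self_vcat : vcat :=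
  @VCat obj ihom comp_mor id_mor self_compA self_comp1f self_compf1.

End Category.

(* Main.v *)
From HB Require Import structures.
Require Import Defs.
From mathcomp Require Import all_boot all_order all_algebra.
From mathcomp Require Import boolp classical_sets functions reals.
From mathcomp Require Import complex.
From mathcomp Require Import ring lra.

Set Implicit Arguments.
Unset Strict Implicit.
Unset Printing Implicit Defensive.

Import Order.TTheory GRing.Theory Num.Theory.
Local Open Scope classical_set_scope.
Local Open Scope ring_scope.

(** Everything rests on one description: h is orthogonal to the scalar field,
    that is, h^* is an isometric bijection, exactly when h is isometric with
    dense range.  If h^* is bijective and isometric, every functional phi on V
    of norm at most 1 is psi o h with psi of norm at most 1, so
    |phi v| <= |h v|; choosing phi with |phi v| = |v| makes h isometric
    ([dual_iso_isometric]).  The range of h is dense because a functional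
    dominated by the distance to that range is killed by h^*, hence zero
    ([dual_iso_dense]).  Both functionals come from
    [hahn_banach_seminorm], proved by applying Zorn's lemma to sublinear
    functionals, whose minimal elements are linear.

    A bounded map from V into a Banach space extends uniquely and without
    increase of norm along a dense isometry ([dense_isometry_orthogonal]).  So
    every Banach space B satisfies: h orthogonal to the scalars implies h
    orthogonal to B ([banach_orthogonal]).

    The completion of V is the closure of V in its bidual, and its unit is a
    dense isometry, so it is orthogonal to every Banach space.  This gives the
    reflection onto Banach spaces ([banach_vreflective]).  It also gives the
    converse criterion: if B satisfies the implication above, its completion
    unit is orthogonal to B and to the completion, and a map orthogonal to its
    own source and target is invertible ([orthogonal_is_iso]).

    Minimality of the hull is the same argument with an arbitrary reflection:
    the unit B -> F B of a reflective subcategory containing the scalars is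
    orthogonal to the scalars, hence to a Banach space B, and also to F B, so B
    is isomorphic to F B and lies in the subcategory
    ([vreflective_contains_banach]). *)

(** * Preliminaries on real and complex numbers *)

Section Infimum.
Context (R : realType).
Implicit Types A B C : set R.

Lemma inf_leD A B C : A !=set0 -> B !=set0 -> has_lbound C ->
  (forall a b, A a -> B b -> exists2 c, C c & c <= a + b) ->
  inf C <= inf A + inf B.
Proof.
move=> A0 B0 Cb CAB; rewrite -lerBlDr; apply: lb_le_inf => // a Aa.
rewrite lerBlDr -lerBlDl; apply: lb_le_inf => // b Bb; rewrite lerBlDl.
by have [c Cc] := CAB a b Aa Bb; apply: le_trans; apply: ge_inf.
Qed.

Lemma inf_leM A C (r : R) : A !=set0 -> has_lbound C -> 0 <= r ->
  (forall a, A a -> exists2 c, C c & c <= r * a) -> inf C <= r * inf A.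
Proof.
move=> [a0 Aa0] Cb; rewrite le0r => /orP[/eqP-> CA|r0 CA].
  have [c Cc] := CA a0 Aa0; rewrite !mul0r; apply: le_trans; exact: ge_inf.
rewrite -ler_pdivrMl//; apply: lb_le_inf; first by exists a0.
move=> a Aa; rewrite ler_pdivrMl//.
by have [c Cc] := CA a Aa; apply: le_trans; apply: ge_inf.
Qed.

End Infimum.

Lemma normc_ge_re (R : realType) (a b : R) : `|a| <= Normc.normc (a +i* b)%C.
Proof. by rewrite -sqrtr_sqr /= ler_sqrt ?addr_ge0 ?sqr_ge0// lerDl sqr_ge0. Qed.

Lemma normc_ge_im (R : realType) (a b : R) : `|b| <= Normc.normc (a +i* b)%C.
Proof. by rewrite -sqrtr_sqr /= ler_sqrt ?addr_ge0 ?sqr_ge0// lerDr sqr_ge0. Qed.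

Lemma normc_le_sum (R : realType) (a b : R) : Normc.normc (a +i* b)%C <= `|a| + `|b|.
Proof.
have := le_normcD (a +i* 0)%C (0 +i* b)%C.
rewrite [(_ + _)%R]/GRing.add /= addr0 add0r => /le_trans; apply.
by rewrite expr0n /= addr0 add0r !sqrtr_sqr.
Qed.

Lemma le_eps (R : realType) (x y c : R) :
  (forall e, 0 < e -> x <= y + c * e) -> x <= y.
Proof.
move=> xyc; apply/ler_addgt0Pr => e e0.
have c1 : 0 < `|c| + 1 by apply: ltr_wpDl.
apply: le_trans (xyc (e / (`|c| + 1)) _) _; first exact: divr_gt0.
rewrite lerD2l mulrCA ger_pMr// ler_pdivrMr// mul1r.
by rewrite (le_trans (ler_norm c))// lerDl.
Qed.

(** * The Hahn-Banach theorem for seminorms *)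

Section Sublinear.
Context (R : realType) (K : nzRingType) (iota : {rmorphism R -> K}).
Context (V : lmodType K).
Implicit Types (p q m : V -> R) (u v w : V).

(** The scalars of V form a ring K containing R through iota, so that real and
    complex spaces are treated at once.  Inequality for r > 0 is enough:
    applying it to r^-1 gives equality, and r = 2 and r = 1/2 give p 0 = 0. *)
Definition sublinear p : Prop :=
  (forall u v, p (u + v) <= p u + p v) /\
  (forall (r : R) u, 0 < r -> p (iota r *: u) <= r * p u).

Lemma sublinear0 p : sublinear p -> p 0 = 0.
Proof.
move=> [_ pZ]; apply/eqP; rewrite eq_le; apply/andP; split.
  have := pZ (2^-1) 0; rewrite scaler0 invr_gt0 ltr0n => /(_ isT); lra.
have := pZ 2 0; rewrite scaler0 ltr0n => /(_ isT); lra.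
Qed.

Lemma sublinear_leN p u : sublinear p -> - p (- u) <= p u.
Proof.
move=> ps; have [pD _] := ps.
by have := pD u (- u); rewrite subrr (sublinear0 ps); lra.
Qed.

Lemma sublinear_iotaZ p (t : R) u : sublinear p -> 0 <= t -> p (iota t *: u) = t * p u.
Proof.
move=> ps; have [_ pZ] := ps; rewrite le0r => /orP[/eqP->|t0].
  by rewrite rmorph0 scale0r mul0r sublinear0.
apply/eqP; rewrite eq_le pZ//= -ler_pdivlMl//.
apply: le_trans (pZ _ (iota t *: u) _); last by rewrite invr_gt0.
by rewrite scalerA -rmorphM/= mulVf ?gt_eqF// rmorph1 scale1r.
Qed.

(** Zorn's lemma: the pointwise infimum of a chain of sublinear functionals
    below p is finite, because each is bounded below by - p (- u), and it is
    subadditive because two members of a chain have a smaller one. *)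
Lemma minimal_sublinear p : sublinear p ->
  exists m, [/\ sublinear m, forall u, m u <= p u &
    forall q, sublinear q -> (forall u, q u <= m u) -> q = m].
Proof.
move=> ps; pose P q := sublinear q /\ forall u, q u <= p u.
pose T := {q | P q}.
pose below (s t : T) := `[< forall u, sval t u <= sval s u >].
have [||||[m [ms mp]] mmin] := @Zorn T below.
- by move=> t; apply/asboolP.
- move=> r s t /asboolP rs /asboolP st; apply/asboolP => u.
  exact: le_trans (st u) (rs u).
- move=> [s Ps] [t Pt] /asboolP/= st /asboolP/= ts; apply/eq_exist.
  by apply/funext => u; apply/eqP; rewrite eq_le st ts.
- move=> A Atot.
  have [A0|/forallNP A0] := pselect (exists t, A t); last first.
    by exists (exist P p (conj ps (fun u => lexx (p u)))) => s /A0.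
  pose E u := [set sval t u | t in A].
  have E0 u : E u !=set0 by have [t At] := A0; exists (sval t u), t.
  have Eb u : has_lbound (E u).
    exists (- p (- u)) => _ [[q [qs qp]] Aq <-] /=.
    by apply: le_trans (sublinear_leN u qs); rewrite lerN2.
  have Es : sublinear (fun u => inf (E u)).
    split=> [u v|r u r0].
      apply: inf_leD => // _ _ [s As <-] [t At <-].
      have [/asboolP st|/asboolP ts] := Atot s t As At.
        exists (sval t (u + v)); first by exists t.
        by have [[tD _] _] := svalP t; apply: le_trans (tD _ _) _; rewrite lerD.
      exists (sval s (u + v)); first by exists s.
      by have [[sD _] _] := svalP s; apply: le_trans (sD _ _) _; rewrite lerD.
    apply: inf_leM (ltW r0) _ => // _ [t At <-].
    exists (sval t (iota r *: u)); first by exists t.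
    by have [[_ tZ] _] := svalP t; exact: tZ.
  have Ep u : inf (E u) <= p u.
    have [t At] := A0; have [_ tp] := svalP t; apply: le_trans (tp u).
    by apply: ge_inf => //; exists t.
  exists (exist P (fun u => inf (E u)) (conj Es Ep)) => s As; apply/asboolP => u /=.
  by apply: ge_inf => //; exists s.
exists m; split=> // q qs qm.
have qp u : q u <= p u := le_trans (qm u) (mp u).
have /(congr1 sval) : exist P q (conj qs qp) = exist P m (conj ms mp).
  by apply: mmin; apply/asboolP.
by [].
Qed.

Section Tilt.
Context (p : V -> R) (y : V).
Hypothesis ps : sublinear p.

(** Lowering p in the direction - y as far as sublinearity permits: the
    infimum below is a sublinear functional under p whose value at - y is at
    most - p y. *)
Definition tilt_values u : set R :=
  [set p (u + iota t *: y) - t * p y | t in [set t : R | 0 <= t]].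

Definition tilt u : R := inf (tilt_values u).

Lemma tilt_values_neq0 u : tilt_values u !=set0.
Proof. by exists (p (u + iota 0 *: y) - 0 * p y), 0 => /=. Qed.

Lemma tilt_values_has_lbound u : has_lbound (tilt_values u).
Proof.
have [pD _] := ps; exists (- p (- u)) => _ [t /= t0 <-].
have := pD (u + iota t *: y) (- u).
by rewrite addrAC subrr add0r sublinear_iotaZ//; lra.
Qed.

Lemma tilt_le t u : 0 <= t -> tilt u <= p (u + iota t *: y) - t * p y.
Proof.
by move=> t0; apply: ge_inf; [exact: tilt_values_has_lbound | exists t].
Qed.

Lemma tilt_sublinear : sublinear tilt.
Proof.
have [pD pZ] := ps.
split=> [u v|r u r0]; [apply: inf_leD|apply: inf_leM (ltW r0) _];
  try exact: tilt_values_neq0; try exact: tilt_values_has_lbound.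
  move=> _ _ [s /= s0 <-] [t /= t0 <-].
  exists (p (u + v + iota (s + t) *: y) - (s + t) * p y).
    by exists (s + t) => //=; exact: addr_ge0.
  have := pD (u + iota s *: y) (v + iota t *: y).
  by rewrite addrACA -scalerDl -rmorphD/=; lra.
move=> _ [t /= t0 <-].
exists (p (iota r *: u + iota (r * t) *: y) - (r * t) * p y).
  by exists (r * t) => //=; rewrite mulr_ge0// ltW.
have := pZ r (u + iota t *: y) r0.
by rewrite scalerDr scalerA -rmorphM/=; lra.
Qed.

Lemma tilt_le_id u : tilt u <= p u.
Proof.
by have := tilt_le u (lexx 0); rewrite rmorph0 scale0r addr0 mul0r subr0.
Qed.

Lemma tilt_leN : tilt (- y) <= - p y.
Proof.
have := tilt_le (- y) ler01.
by rewrite rmorph1 scale1r addNr sublinear0// mul1r sub0r.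
Qed.

End Tilt.

(** A minimal sublinear functional m equals all its tilts, so m (- y) <= - m y
    for every y; this makes m odd, hence linear.  Starting from the tilt of p in
    the direction w, rather than from p, also forces - m w = m (- w) <= - p w. *)
Lemma sublinear_dominates_linear p w : sublinear p ->
  exists m, [/\ forall u v, m (u + v) = m u + m v,
    forall (r : R) u, m (iota r *: u) = r * m u,
    forall u, m u <= p u & p w <= m w].
Proof.
move=> ps; have [m [ms mp mmin]] := minimal_sublinear (tilt_sublinear w ps).
have mN u : m (- u) = - m u.
  apply/eqP; rewrite eq_le; apply/andP; split; last first.
    by have := sublinear_leN u ms; lra.
  have /(congr1 (fun f => f (- u))) <- := mmin _ (tilt_sublinear u ms) (tilt_le_id u ms).
  exact: tilt_leN.
have [mD _] := ms; exists m; split.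
- move=> u v; apply/eqP; rewrite eq_le mD/=.
  by have := mD (u + v) (- v); rewrite addrK mN; lra.
- move=> r u; have [r0|r0] := leP 0 r; first exact: sublinear_iotaZ.
  rewrite -[r]opprK rmorphN scaleNr mN sublinear_iotaZ ?mulNr//.
  by rewrite oppr_ge0 ltW.
- by move=> u; apply: le_trans (mp u) _; exact: tilt_le_id.
- by have := le_trans (mp (- w)) (tilt_leN w ps); rewrite mN lerN2.
Qed.

End Sublinear.

(** Over the complex numbers, a real-linear u dominated by q is the real part
    of the complex-linear phi v = u v - i u (i v).  Evaluating u at
    conj (phi v) *: v, where its value is |phi v|^2, carries the domination
    from u over to phi. *)
Theorem hahn_banach_seminorm (R : realType) (k : scalar_kind)
    (V : lmodType (scalar_field R k)) (q : V -> R) (w : V) :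
  (forall u v, q (u + v) <= q u + q v) ->
  (forall a u, q (a *: u) <= modulus a * q u) ->
  exists phi : V -> scalar_space R k,
    [/\ linear phi, forall v, `|phi v| <= q v :> R & q w <= `|phi w|].
Proof.
case: k V q w => V q w qD qZ.
  have qs : @sublinear R R idfun V q.
    by split=> // r u r0; have := qZ r u; rewrite /= gtr0_norm.
  have [m [mD mZ mq mw]] := sublinear_dominates_linear w qs.
  exists m; split; first by move=> a u v; rewrite mD mZ.
    move=> v; change (`|m v : R| <= q v); rewrite ler_norml mq andbT lerNl.
    apply: le_trans (_ : m (- v) <= _); first by rewrite -scaleN1r mZ mulN1r.
    by apply: le_trans (mq _) _; rewrite -scaleN1r; have := qZ (-1) v;
       rewrite /= normrN1 mul1r.
  by apply: le_trans mw _; exact: ler_norm (m w : R).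
have qs : @sublinear R R[i] (real_complex R) V q.
  split=> // r u r0; have := qZ (r%:C)%C u.
  by rewrite /= expr0n addr0 sqrtr_sqr gtr0_norm.
have [u [uD uZ uq uw]] := sublinear_dominates_linear w qs.
have uN v : u (- v) = - u v.
  by have := uZ (-1) v; rewrite rmorphN1 scaleN1r mulN1r.
pose phi v : R[i] := (u v -i* u ('i%C *: v))%C.
(* u is only real-linear; this is its behaviour under complex scalars. *)
have uC (b : R[i]) v :
    u (b *: v) = complex.Re b * u v + complex.Im b * u ('i%C *: v).
  by rewrite [in LHS](complexE b) scalerDl uD uZ ['i%C * _]mulrC -scalerA uZ.
have phi_lin (a : R[i]) x y : phi (a *: x + y) = a * phi x + phi y.
  have ii v : u ('i%C *: ('i%C *: v)) = - u v.
    by rewrite scalerA -expr2 sqr_i scaleN1r uN.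
  have uix : u ('i%C *: (a *: x)) = u (a *: ('i%C *: x)).
    by rewrite !scalerA [a * _]mulrC.
  have e1 : u (a *: x + y) = complex.Re a * u x + complex.Im a * u ('i%C *: x) + u y.
    by rewrite uD uC.
  have e2 : u ('i%C *: (a *: x + y)) =
      complex.Re a * u ('i%C *: x) - complex.Im a * u x + u ('i%C *: y).
    by rewrite scalerDr uD uix uC ii mulrN.
  rewrite /phi e1 e2.
  move: (u x) (u y) (u ('i%C *: x)) (u ('i%C *: y)) => ux uy uix' uiy.
  case: a {uix ii e1 e2} => a b; rewrite [in RHS]/GRing.mul [in RHS]/GRing.add /=.
  congr Complex; ring.
exists phi; split => //.
  move=> v; change (Normc.normc (phi v) <= q v).
  pose z := phi v; pose n := Normc.normc z; rewrite -/z -/n.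
  have n_ge0 : 0 <= n := modulus_ge0 (z : scalar_field R ComplexScalars).
  have nn : n * n = u ((z^*)%C *: v).
    rewrite uC /n /z /phi /= opprK -!expr2.
    by rewrite sqr_sqrtr ?addr_ge0 ?sqr_ge0// sqrrN.
  have q_ge0 : 0 <= q v.
    have := qD v (- v); have := qZ (-1) v; have := qD 0 0.
    by rewrite addr0 subrr scaleN1r modulusN modulus1 mul1r; lra.
  move: n_ge0; rewrite le0r => /orP[/eqP->//|n0].
  rewrite -(ler_pM2l n0) nn; apply: le_trans (uq _) _.
  apply: le_trans (qZ _ _) _; rewrite ler_wpM2r//.
  by rewrite /n; case: (z) => a b /=; rewrite sqrrN.
apply: le_trans uw _; change (u w <= Normc.normc (phi w)).
exact: le_trans (ler_norm _) (normc_ge_re _ _).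
Qed.

(** * Morphisms orthogonal to the scalars are dense isometries *)

Section Density.
Context (R : realType) (k : scalar_kind) (fl : flavour).
Implicit Types V W B : obj R k fl.

Definition isometric V W (h : mor V W) : Prop := forall v, `|h v| = `|v| :> R.

Definition dense_range V W (h : mor V W) : Prop :=
  forall w (e : R), 0 < e -> exists v, `|w - h v| < e.

Lemma dominated_functional V (q : V -> R) (w : V) :
  (forall u v, q (u + v) <= q u + q v) ->
  (forall a u, q (a *: u) <= modulus a * q u) ->
  (forall v, q v <= `|v|) ->
  exists phi : vdual V, [/\ `|phi| <= 1 :> R,
    forall v, `|app phi v| <= q v :> R & q w <= `|app phi w|].
Proof.
move=> qD qZ q1; have [phi [phi_lin phiq phiw]] := hahn_banach_seminorm w qD qZ.
have phi1 v : `|phi v| <= `|v| :> R by exact: le_trans (phiq v) (q1 v).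
have phi_in : phi \in @bounded_linear R k V (unit_obj R k fl).
  by apply/asboolP; split=> //; exists 1 => v; rewrite mul1r.
exists (BHom phi_in); split=> //.
by apply: opnorm_le => // v; rewrite mul1r.
Qed.

Lemma norming_functional V (v : V) :
  exists2 phi : vdual V, `|phi| <= 1 :> R & `|v| <= `|app phi v| :> R.
Proof.
have [|||phi [phi1 _ phiv]] := @dominated_functional V (fun u => `|u| : R) v.
- exact: ler_normD.
- by move=> a u; rewrite snormrZ.
- by [].
- by exists phi.
Qed.

(** A functional norming v factors as psi o h with psi of norm at most 1. *)
Lemma dual_iso_isometric V W (h : mor V W) :
  vorthogonal h (unit_obj R k fl) -> isometric h.
Proof.
move=> [g [_ gK]] v; apply/eqP; rewrite eq_le mor_nonexpansive /=.
have [phi phi1 phiv] := norming_functional v.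
apply: le_trans phiv _; rewrite -[in leLHS](gK phi).
apply: le_trans (opnormP (g phi) (h v)) _; rewrite ler_piMl//.
exact: le_trans (mor_nonexpansive g phi) phi1.
Qed.

Section Distance.
Context V W (h : mor V W).

(** The quotient seminorm of W by the range of h, written on W itself. *)
Definition range_distance (w : W) : R := inf [set (`|w - h v| : R) | v in [set: V]].

Local Notation dist_set w := [set (`|w - h v| : R) | v in [set: V]].

Let dist_set_neq0 w : dist_set w !=set0.
Proof. by exists `|w - h 0|, 0. Qed.

Let dist_set_lbound w : has_lbound (dist_set w).
Proof. by exists 0 => _ [v _ <-]. Qed.

Lemma range_distance_le w v : range_distance w <= `|w - h v|.
Proof. by apply: ge_inf; [exact: dist_set_lbound | exists v]. Qed.

Lemma range_distance_ge w (e : R) : (forall v, e <= `|w - h v|) ->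
  e <= range_distance w.
Proof. by move=> ew; apply: lb_le_inf => // _ [v _ <-]. Qed.

Lemma range_distanceD u v :
  range_distance (u + v) <= range_distance u + range_distance v.
Proof.
apply: inf_leD => // _ _ [x _ <-] [y _ <-].
exists `|u + v - h (x + y)|; first by exists (x + y).
by rewrite linearD opprD addrACA ler_normD.
Qed.

Lemma range_distanceZ a u : range_distance (a *: u) <= modulus a * range_distance u.
Proof.
apply: inf_leM (modulus_ge0 _) _ => // _ [x _ <-].
exists `|a *: u - h (a *: x)|; first by exists (a *: x).
by rewrite linearZ -scalerBr snormrZ.
Qed.

End Distance.

(** If w stays at positive distance from the range, a functional dominated by
    the distance and large at w is nonzero, yet h^* sends it to 0. *)
Lemma dual_iso_dense V W (h : mor V W) :
  vorthogonal h (unit_obj R k fl) -> dense_range h.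
Proof.
move=> [g [hK _]] w e e0; apply: contrapT => /forallNP farw.
have dle := range_distance_le h.
have [|||phi [_ phid phiw]] := @dominated_functional W (range_distance h) w.
- exact: range_distanceD.
- exact: range_distanceZ.
- by move=> v; have := dle v 0; rewrite linear0 subr0.
have phi0 : phi = 0.
  apply: (can_inj hK); apply: bhom_ext => v.
  apply: scalar_definite; apply/eqP; rewrite eq_le normr_ge0 andbT.
  apply: le_trans (phid (h v)) _.
  by have := dle (h v) v; rewrite subrr normr0.
have : e <= range_distance h w.
  by apply: range_distance_ge => v; rewrite leNgt; apply/negP => /farw.
by rewrite leNgt (le_lt_trans phiw)// phi0 normr0.
Qed.

Lemma norm_le_eps V (v : V) (c : R) : norm_definite V ->
  (forall e : R, 0 < e -> `|v| <= c * e) -> v = 0.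
Proof.
move=> Vdef vc; apply: Vdef; apply/eqP; rewrite eq_le normr_ge0 andbT.
by apply: (@le_eps _ _ 0 c) => e e0; rewrite add0r vc.
Qed.

End Density.

(** * Extension along dense isometries *)

Section Sequences.
Context (R : realType) (k : scalar_kind) (fl : flavour).
Implicit Types V W : obj R k fl.

Lemma invn_lt_eventually (e : R) : 0 < e ->
  exists N, forall n, (N <= n)%N -> n.+1%:R^-1 < e.
Proof.
move=> e0; have [N Ne] := ltr_add_invr e0; exists N => n Nn.
rewrite add0r in Ne; apply: le_lt_trans Ne.
by rewrite lef_pV2 ?posrE// ler_nat.
Qed.

Lemma appB V W (f : ihom V W) u v : app f (u - v) = app f u - app f v.
Proof. exact: (linearB (f : bhom V W)). Qed.

Lemma app0 V W (f : ihom V W) : app f 0 = 0.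
Proof. exact: (linear0 (f : bhom V W)). Qed.

Lemma app_le V W (f : ihom V W) v : `|app f v| <= `|f| * `|v| :> R.
Proof. exact: opnormP. Qed.

Lemma converges_to_le V (u : nat -> V) (l x : V) (c : R) (N : nat) :
  converges_to u l -> (forall n, (N <= n)%N -> `|u n - x| <= c) -> `|l - x| <= c.
Proof.
move=> ul ux; apply/ler_addgt0Pl => e /ul[M uM].
apply: le_trans (ler_distD (u (maxn M N)) _ _) _.
by rewrite lerD ?ux ?leq_maxr// distrC ltW// uM ?leq_maxl.
Qed.

End Sequences.

Section Extension.
Context (R : realType) (k : scalar_kind) (fl : flavour).
Context (V W B : obj R k fl) (h : mor V W).

Lemma dense_range_inj (f g : ihom W B) : norm_definite B -> dense_range h ->
  precomp_fun h f = precomp_fun h g -> f = g.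
Proof.
move=> Bdef hd fg; apply: bhom_ext => w; apply/eqP; rewrite -subr_eq0; apply/eqP.
apply: (norm_le_eps (c := `|f - g|) Bdef) => e e0; have [v wv] := hd w e e0.
have fgv : app (f - g) (h v) = 0.
  rewrite /app bhom_DE bhom_NE; apply/eqP; rewrite subr_eq0; apply/eqP.
  exact: (congr1 (fun u : ihom V B => app u v) fg).
have -> : f w - g w = app (f - g) (w - h v).
  by rewrite appB fgv subr0.
apply: le_trans (app_le _ _) _; rewrite ler_wpM2l//; exact: ltW.
Qed.

Hypothesis Bban : banach B.
Hypothesis hi : isometric h.
Hypothesis hd : dense_range h.

(** For w = lim h v_n, this inequality characterizes b = lim f v_n without
    mentioning a sequence, so that linearity, the norm bound and the values on
    the range of h are all read off from it. *)
Definition extends_at (f : ihom V B) (w : W) (b : B) : Prop :=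
  forall v, `|b - app f v| <= `|f| * `|w - h v| :> R.

Lemma extends_at_exists f w : exists b, extends_at f w b.
Proof.
have [|u hu] := @choice _ _ (fun n v => `|w - h v| < n.+1%:R^-1 :> R).
  by move=> n; apply: hd; rewrite invr_gt0.
have fu v n : `|app f (u n) - app f v| <= `|f| * (`|w - h v| + n.+1%:R^-1) :> R.
  rewrite -appB; apply: le_trans (app_le f _) _.
  rewrite ler_wpM2l// -hi linearB.
  apply: le_trans (ler_distD w _ _) _.
  by rewrite addrC lerD2l distrC ltW.
have f1 : 0 < `|f| + 1 :> R by rewrite ltr_wpDl.
have fle (e : R) : 0 < e -> `|f| * (e / (`|f| + 1)) <= e.
  move=> e0; rewrite mulrCA ger_pMr// ler_pdivrMr// mul1r lerDl//.
have [|b ub] := (proj2 Bban) (fun n => app f (u n)).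
  move=> e e0; have [|N Ne] := @invn_lt_eventually R (e / 2 / 2 / (`|f| + 1)).
    by rewrite !divr_gt0.
  exists N => m n Nm Nn; apply: le_lt_trans (fu (u n) m) _.
  apply: (@le_lt_trans _ _ (`|f| * ((e / 2) / (`|f| + 1)))).
    rewrite ler_wpM2l// [e / 2]splitr mulrDl lerD// ltW//.
      exact: lt_trans (hu n) (Ne n Nn).
    exact: Ne.
  by apply: le_lt_trans (fle _ _) _; lra.
exists b => v; apply/ler_addgt0Pr => e e0.
have [|N Ne] := @invn_lt_eventually R (e / (`|f| + 1)); first exact: divr_gt0.
apply: (converges_to_le (N := N) ub) => n Nn; apply: le_trans (fu v n) _.
rewrite mulrDr lerD2l; apply: le_trans (fle e e0).
by rewrite ler_wpM2l// ltW// Ne.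
Qed.

(** The inverse of restriction along h sends f to the map determined by
    [extends_at f]; taking v = 0 there shows that the norm does not increase. *)
Lemma dense_isometry_orthogonal : vorthogonal h B.
Proof.
have [E Eext] : exists E : ihom V B -> W -> B, forall f w, extends_at f w (E f w).
  have [e ex] := choice (fun fw : ihom V B * W => extends_at_exists fw.1 fw.2).
  by exists (fun f w => e (f, w)) => f w; exact: (ex (f, w)).
have Eh f v : E f (h v) = app f v.
  apply/eqP; rewrite -subr_eq0; apply/eqP/(proj1 Bban)/eqP.
  rewrite eq_le normr_ge0 andbT; apply: le_trans (Eext f (h v) v) _.
  by rewrite subrr normr0 mulr0.
have Elin f : linear (E f).
  move=> a x y; apply/eqP; rewrite -subr_eq0; apply/eqP.
  (* Compare both sides with f (a *: v + v'), where h v and h v' are within e of x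
     and y: each comparison costs |f| (|a| + 1) e. *)
  apply: (norm_le_eps (c := `|f| * (modulus a + 1) * 2) (proj1 Bban)) => e e0.
  have [v xv] := hd x e0; have [v' yv] := hd y e0.
  have dxy : `|a *: x + y - h (a *: v + v')| <= (modulus a + 1) * e.
    rewrite linearP opprD addrACA -scalerBr; apply: le_trans (ler_normD _ _) _.
    by rewrite snormrZ mulrDl mul1r lerD ?ler_wpM2l ?modulus_ge0// ltW.
  apply: le_trans (ler_distD (app f (a *: v + v')) _ _) _.
  rewrite mulr2n mulrDr mulr1 mulrDl; apply: lerD.
    apply: le_trans (Eext f _ _) _; rewrite -mulrA ler_wpM2l//.
  rewrite /app (@bhom_linear _ _ _ _ f) opprD addrACA -scalerBr.
  apply: le_trans (ler_normD _ _) _.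
  rewrite snormrZ distrC [`|bhom_fun f v' - _|]distrC.
  have Efle z u : `|z - h u| < e -> `|E f z - app f u| <= `|f| * e.
    by move=> zu; apply: le_trans (Eext f z u) _; rewrite ler_wpM2l// ltW.
  rewrite -mulrA mulrDl mul1r mulrDr; apply: lerD; last exact: Efle.
  by rewrite mulrCA ler_wpM2l ?modulus_ge0// Efle.
have Ebound f w : `|E f w| <= `|f| * `|w| :> R.
  by have := Eext f w 0; rewrite app0 subr0 linear0 subr0.
have Ein f : E f \in @bounded_linear R k W B.
  by apply/asboolP; split=> //; exists `|f|.
pose ext f : ihom W B := BHom (Ein f).
have hext : cancel ext (precomp h B).
  by move=> f; apply: bhom_ext => v; exact: Eh.
have inj : injective (precomp h B).
  by move=> f g; apply: dense_range_inj => //; exact: (proj1 Bban).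
have extlin : linear ext.
  move=> a f g; apply: inj; rewrite hext (linearP (precomp h B)).
  by rewrite !hext.
pose extL : {linear ihom V B -> ihom W B} :=
  HB.pack ext (GRing.isLinear.Build _ _ _ _ ext extlin).
have ext1 f : `|extL f| <= `|f| :> R by apply: opnorm_le => // w; exact: Ebound.
exists (@Mor _ _ _ (ihom V B) (ihom W B) extL ext1); split => //.
by move=> f; apply: inj; exact: hext.
Qed.

End Extension.

(** * Completeness and completions *)

Section ScalarCompleteness.
Context (R : realType).

(** The limit is the supremum of the numbers eventually below the sequence. *)
Lemma real_cauchy_converges (u : nat -> R) :
  (forall e : R, 0 < e -> exists N : nat, forall m n : nat,
    (N <= m)%N -> (N <= n)%N -> `|u m - u n| < e) ->
  exists l : R, forall e : R, 0 < e -> exists N : nat, forall n : nat,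
    (N <= n)%N -> `|u n - l| < e.
Proof.
move=> ucauchy.
pose S := [set x | exists N, forall n, (N <= n)%N -> x <= u n].
have near_sup (e : R) N : 0 < e ->
    (forall n, (N <= n)%N -> `|u n - u N| <= e) -> `|u N - sup S| <= e.
  move=> e0 uN.
  have SuN : S (u N - e).
    by exists N => n /uN; rewrite ler_norml; lra.
  have ubS : ubound S (u N + e).
    move=> x [M xM]; have := xM (maxn M N) (leq_maxl _ _).
    by have := uN (maxn M N) (leq_maxr _ _); rewrite ler_norml; lra.
  have : u N - e <= sup S by apply: ub_le_sup => //; exists (u N + e).
  have : sup S <= u N + e by apply: ge_sup => //; exists (u N - e).
  by rewrite ler_norml; lra.
exists (sup S) => e e0; have [|N uN] := ucauchy (e / 2); first exact: divr_gt0.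
exists N => n Nn; apply: le_lt_trans (ler_distD (u N) _ _) _.
have : `|u N - sup S| <= e / 2.
  by apply: near_sup => [|i Ni]; [exact: divr_gt0 | exact: ltW (uN i N Ni (leqnn N))].
by have := uN n N Nn (leqnn N); lra.
Qed.

Lemma unit_banach (k : scalar_kind) (fl : flavour) : banach (unit_obj R k fl).
Proof.
split; first exact: scalar_definite.
case: k => u ucauchy; first exact: real_cauchy_converges ucauchy.
have [|a ua] := @real_cauchy_converges (fun n => complex.Re (u n : R[i])).
  move=> e /ucauchy[N uN]; exists N => m n Nm Nn; apply: le_lt_trans (uN m n Nm Nn).
  change (`|complex.Re (u m : R[i]) - complex.Re (u n : R[i])|
    <= Normc.normc ((u m : R[i]) - u n)).
  by case: (u m) (u n) => [a b] [c d]; exact: normc_ge_re.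
have [|b ub] := @real_cauchy_converges (fun n => complex.Im (u n : R[i])).
  move=> e /ucauchy[N uN]; exists N => m n Nm Nn; apply: le_lt_trans (uN m n Nm Nn).
  change (`|complex.Im (u m : R[i]) - complex.Im (u n : R[i])|
    <= Normc.normc ((u m : R[i]) - u n)).
  by case: (u m) (u n) => [x y] [c d]; exact: normc_ge_im.
exists (a +i* b)%C => e e0.
have [|N uN] := ua (e / 2); first exact: divr_gt0.
have [|M uM] := ub (e / 2); first exact: divr_gt0.
exists (maxn N M) => n; rewrite geq_max => /andP[/uN una /uM unb].
change (Normc.normc ((u n : R[i]) - (a +i* b)%C) < e).
move: una unb; case: (u n) => x y /= una unb.
by apply: le_lt_trans (normc_le_sum _ _) _; rewrite [e]splitr ltrD.
Qed.

End ScalarCompleteness.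

Section Completion.
Context (R : realType) (k : scalar_kind) (fl : flavour).
Implicit Types V W B : obj R k fl.

(** A Cauchy sequence of bounded maps converges pointwise, and the Cauchy
    estimate passes to the limit uniformly on the unit ball; that estimate gives
    linearity and boundedness of the limit as well as convergence in norm. *)
Lemma ihom_banach V B : banach B -> banach (ihom V B).
Proof.
move=> [Bdef Bcomplete]; split; first exact: bhom_definite.
move=> u ucauchy.
have [l ul] : exists l : V -> B, forall v, converges_to (fun n => app (u n) v) (l v).
  have [|l ?] := @choice V B (fun v b => converges_to (fun n => app (u n) v) b);
    last by exists l.
  move=> v; apply: Bcomplete => e e0.
  have v1 : 0 < `|v| + 1 :> R by rewrite ltr_wpDl.
  have [|N uN] := ucauchy (e / (`|v| + 1)); first exact: divr_gt0.
  exists N => m n Nm Nn.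
  change (`|app (u m - u n) v| < e); apply: le_lt_trans (app_le _ _) _.
  apply: (@le_lt_trans _ _ (`|u m - u n| * (`|v| + 1))).
    by rewrite ler_wpM2l// lerDl.
  by rewrite -ltr_pdivlMr// uN.
have near (e : R) : 0 < e -> exists N, forall n, (N <= n)%N ->
    forall v, `|l v - app (u n) v| <= e * `|v|.
  move=> /ucauchy[N uN]; exists N => n Nn v.
  apply: (converges_to_le (N := N) (ul v)) => m Nm.
  change (`|app (u m - u n) v| <= e * `|v|); apply: le_trans (app_le _ _) _.
  by rewrite ler_wpM2r// ltW// uN.
have llin : linear l.
  move=> a x y; apply/eqP; rewrite -subr_eq0; apply/eqP.
  pose c : R := `|a *: x + y| + (modulus a * `|x| + `|y|).
  apply: (norm_le_eps (c := c) Bdef) => e /near[N /(_ N (leqnn N)) uN].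
  apply: le_trans (ler_distD (app (u N) (a *: x + y)) _ _) _.
  rewrite /c mulrDl lerD//; first by rewrite mulrC uN.
  rewrite /app (@bhom_linear _ _ _ _ (u N)) opprD addrACA -scalerBr.
  apply: le_trans (ler_normD _ _) _; rewrite mulrDl lerD//.
    rewrite snormrZ -mulrA ler_wpM2l ?modulus_ge0// distrC mulrC; exact: uN.
  by rewrite distrC mulrC; exact: uN.
have lin : l \in @bounded_linear R k V B.
  apply/asboolP; split=> //; have [N /(_ N (leqnn N)) uN] := near 1 ltr01.
  exists (1 + `|u N|) => v; rewrite mulrDl.
  apply: le_trans (_ : `|l v - app (u N) v| + `|app (u N) v| <= _).
    by have := ler_normD (l v - app (u N) v) (app (u N) v); rewrite subrK.
  by rewrite lerD// app_le.
exists (BHom lin) => e e0.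
have [|N uN] := near (e / 2); first exact: divr_gt0.
exists N => n /uN nl; apply: (@le_lt_trans _ _ (e / 2)); last by lra.
apply: opnorm_le => [|v]; first by rewrite ltW ?divr_gt0.
by have := nl v; rewrite distrC.
Qed.

Definition bidual V : obj R k fl := ihom (vdual V) (unit_obj R k fl).

Lemma bidual_eval_in V (v : V) :
  (fun phi : vdual V => app phi v) \in
    @bounded_linear R k (vdual V) (unit_obj R k fl).
Proof.
apply/asboolP; split=> //.
by exists `|v| => phi; rewrite mulrC app_le.
Qed.

Definition bidual_eval V (v : V) : bidual V := BHom (bidual_eval_in v).

Lemma bidual_eval_linear V : linear (@bidual_eval V).
Proof. by move=> a u v; apply: bhom_ext => phi; exact: (bhom_linear phi). Qed.

(** Evaluation is isometric because every vector has a norming functional. *)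
Lemma bidual_eval_norm V (v : V) : `|bidual_eval v| = `|v| :> R.
Proof.
apply/eqP; rewrite eq_le; apply/andP; split.
  by apply: opnorm_le => // phi; rewrite mulrC app_le.
have [phi phi1 phiv] := norming_functional v.
apply: le_trans phiv _; apply: le_trans (app_le (bidual_eval v) phi) _.
by rewrite ler_piMr.
Qed.

Section CompletionSpace.
Context (V : obj R k fl).

(** The closure of a seminormed space in its bidual serves as its completion:
    it is complete as a closed subspace of a complete space, and separated even
    when the original space is not. *)
Definition bidual_closure : {pred bidual V} := fun x =>
  `[< forall e : R, 0 < e -> exists v, `|x - bidual_eval v| < e >].

Lemma bidual_closure_submod_closed : submod_closed bidual_closure.
Proof.
split=> [|a x y /asboolP xV /asboolP yV]; apply/asboolP => e e0.
  by exists 0; rewrite sub0r normrN bidual_eval_norm normr0.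
have c0 : 0 < modulus a + 1 by rewrite ltr_wpDl// modulus_ge0.
have [|v xv] := xV (e / 2 / (modulus a + 1)); first by rewrite !divr_gt0.
have [|w yw] := yV (e / 2); first by rewrite !divr_gt0.
exists (a *: v + w); rewrite bidual_eval_linear opprD addrACA -scalerBr.
apply: le_lt_trans (ler_normD _ _) _; rewrite [e]splitr ltr_leD//; last exact: ltW.
rewrite snormrZ.
apply: (@le_lt_trans _ _ ((modulus a + 1) * `|x - bidual_eval v|)).
  by rewrite ler_wpM2r// lerDl.
by rewrite mulrC -ltr_pdivlMr.
Qed.

HB.instance Definition _ :=
  GRing.isSubmodClosed.Build _ _ bidual_closure bidual_closure_submod_closed.

Record completion_space := CompletionPoint {
  completion_val :> bidual V;
  completionP : completion_val \in bidual_closure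
}.

HB.instance Definition _ := [isSub for completion_val].
HB.instance Definition _ := [Choice of completion_space by <:].
HB.instance Definition _ := [SubChoice_isSubLmodule of completion_space by <:].

Definition completion_norm (x : completion_space) : R := `|completion_val x|.

Lemma completion_normD x y :
  completion_norm (x + y) <= completion_norm x + completion_norm y.
Proof. exact: ler_normD. Qed.

Lemma completion_normMn x n : completion_norm (x *+ n) = completion_norm x *+ n.
Proof. by rewrite /completion_norm -normrMn; congr `| _ |; exact: (raddfMn val). Qed.

Lemma completion_normN x : completion_norm (- x) = completion_norm x.
Proof. exact: normrN. Qed.

HB.instance Definition _ := @Num.Zmodule_isSemiNormed.Build R completion_space
  completion_norm completion_normD completion_normMn completion_normN.

Lemma completion_normZ (a : scalar_field R k) (x : completion_space) :
  `|a *: x| = modulus a * `|x| :> R.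
Proof. exact: (snormrZ a (completion_val x)). Qed.

HB.instance Definition _ := @isSemiNormedModule.Build R k completion_space
  completion_normZ.

Lemma completion_definite : norm_definite completion_space.
Proof.
move=> x x0; apply: val_inj.
exact: (proj1 (ihom_banach (vdual V) (unit_banach R k fl))).
Qed.

Definition completion : obj R k fl := Obj (fun=> completion_definite).

Lemma bidual_eval_closure v : bidual_eval v \in bidual_closure.
Proof. by apply/asboolP => e e0; exists v; rewrite subrr normr0. Qed.

Definition completion_fun (v : V) : completion :=
  CompletionPoint (bidual_eval_closure v).

Lemma completion_fun_linear : linear completion_fun.
Proof. by move=> a u v; apply: val_inj; exact: bidual_eval_linear. Qed.

HB.instance Definition _ :=
  GRing.isLinear.Build (scalar_field R k) V completion *:%R completion_fun
    completion_fun_linear.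

Lemma completion_fun_norm v : `|completion_fun v| = `|v| :> R.
Proof. exact: bidual_eval_norm. Qed.

Lemma completion_fun_nonexpansive v : `|completion_fun v| <= `|v| :> R.
Proof. by rewrite completion_fun_norm. Qed.

Definition completion_mor : mor V completion :=
  @Mor _ _ _ V completion completion_fun completion_fun_nonexpansive.

Lemma completion_isometric : isometric completion_mor.
Proof. exact: completion_fun_norm. Qed.

Lemma completion_dense : dense_range completion_mor.
Proof. by move=> w e e0; have /asboolP := completionP w; apply. Qed.

Lemma completion_banach : banach completion.
Proof.
split; first exact: completion_definite.
move=> u ucauchy.
have [//|l ul] := proj2 (ihom_banach (vdual V) (unit_banach R k fl))
  (fun n => completion_val (u n)).
have lin : l \in bidual_closure.
  apply/asboolP => e e0.
  have [|N uN] := ul (e / 2); first exact: divr_gt0.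
  have [|v uv] := @completion_dense (u N) (e / 2); first exact: divr_gt0.
  exists v; apply: le_lt_trans (ler_distD (completion_val (u N)) _ _) _.
  by rewrite [e]splitr ltrD// distrC uN.
by exists (CompletionPoint lin).
Qed.

End CompletionSpace.

End Completion.

(** * Isomorphisms and orthogonality *)

Section Morphisms.
Context (R : realType) (k : scalar_kind) (fl : flavour).
Implicit Types U V W B : obj R k fl.

Lemma contraction_le V W (f : ihom V W) : `|f| <= 1 :> R ->
  forall v, `|app f v| <= `|v| :> R.
Proof. by move=> f1 v; apply: le_trans (app_le f v) _; rewrite ler_piMl. Qed.

Definition mor_of_bhom V W (f : ihom V W) (f1 : `|f| <= 1 :> R) : mor V W :=
  @Mor _ _ _ V W (f : bhom V W) (contraction_le f1).

Lemma mor_comp_nonexpansive U V W (g : mor V W) (f : mor U V) u :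
  `|(g \o f) u| <= `|u| :> R.
Proof. exact: le_trans (mor_nonexpansive g _) (mor_nonexpansive f u). Qed.

Definition mor_comp U V W (g : mor V W) (f : mor U V) : mor U W :=
  @Mor _ _ _ U W (mor_fun g \o mor_fun f) (mor_comp_nonexpansive g f).

Lemma bhom_of_mor_norm V W (f : mor V W) : `|bhom_of_mor f| <= 1 :> R.
Proof. by apply: opnorm_le => // v; rewrite mul1r; exact: mor_nonexpansive. Qed.

Lemma is_iso_ext V W (f g : mor V W) : f =1 g -> is_iso f -> is_iso g.
Proof.
move=> fg [f' [fK f'K]]; exists f'; split=> v; first by rewrite -fg fK.
by rewrite -fg f'K.
Qed.

Lemma banach_iso V W (h : mor V W) : is_iso h -> banach V -> banach W.
Proof.
move=> [g [hK gK]] [Vdef Vcomplete].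
split=> [w w0|u ucauchy].
  rewrite -(gK w) (Vdef (g w)) ?linear0//; apply/eqP.
  by rewrite eq_le normr_ge0 andbT -w0 mor_nonexpansive.
have [|l ul] := Vcomplete (fun n => g (u n)).
  move=> e /ucauchy[N uN]; exists N => m n Nm Nn; rewrite -linearB.
  exact: le_lt_trans (mor_nonexpansive g _) (uN m n Nm Nn).
exists (h l) => e /ul[N uN]; exists N => n Nn; rewrite -(gK (u n)) -linearB.
exact: le_lt_trans (mor_nonexpansive h _) (uN n Nn).
Qed.

(** Orthogonality to V yields g with g o h = id.  Then h o g and id agree after
    composition with h, so they are equal by orthogonality to W. *)
Lemma orthogonal_is_iso V W (h : mor V W) :
  vorthogonal h V -> vorthogonal h W -> is_iso h.
Proof.
move=> [e [_ eK]] [e' [hK _]].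
pose g := e (bid V).
have g1 : `|g| <= 1 :> R.
  apply: le_trans (mor_nonexpansive e (bid V)) _.
  by apply: opnorm_le => // v; rewrite mul1r.
have gh v : app g (h v) = v.
  exact: (congr1 (fun f : ihom V V => app f v) (eK (bid V))).
exists (mor_of_bhom g1); split=> [|w]; first exact: gh.
suff : bcomp (bhom_of_mor h) g = bid W by move=> /(congr1 (fun f : ihom W W => app f w)).
apply: (can_inj hK); apply: bhom_ext => v.
exact: (congr1 h (gh v)).
Qed.

Section Name.
Context V W (f : mor V W).

(** The underlying category of a V-category has as maps a -> b the morphisms
    from the unit object to the hom object; this is the one that represents f. *)
Definition name_fun (a : unit_obj R k fl) : ihom V W :=
  (a : scalar_field R k) *: bhom_of_mor f.

Lemma name_linear : linear name_fun.
Proof. by move=> a b c; rewrite /name_fun scalerDl -scalerA. Qed.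

HB.instance Definition _ := GRing.isLinear.Build (scalar_field R k)
  (unit_obj R k fl) (ihom V W) *:%R name_fun name_linear.

Lemma name_nonexpansive a : `|name_fun a| <= `|a| :> R.
Proof. by rewrite snormrZ ler_piMr ?modulus_ge0 ?bhom_of_mor_norm. Qed.

Definition name : mor (unit_obj R k fl) (ihom V W) :=
  @Mor _ _ _ (unit_obj R k fl) (ihom V W) name_fun name_nonexpansive.

Lemma name1 : name (1 : scalar_field R k) = bhom_of_mor f.
Proof. exact: scale1r. Qed.

End Name.

Lemma hid_self V (v : V) : app (@hid _ _ _ (self_vcat R k fl) V) v = v.
Proof. exact: scale1r. Qed.

Lemma is_iso_visomorphic V W (h : mor V W) : is_iso h ->
  @visomorphic R k fl (self_vcat R k fl) V W.
Proof.
move=> [g [hK gK]]; exists (name h), (name g); rewrite !name1.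
by split; apply: bhom_ext => v; rewrite [RHS]hid_self; [exact: hK | exact: gK].
Qed.

Lemma visomorphic_is_iso V W : @visomorphic R k fl (self_vcat R k fl) V W ->
  exists h : mor V W, is_iso h.
Proof.
move=> [f [g [gf fg]]].
have f1 : `|f (1 : scalar_field R k)| <= 1 :> R.
  by apply: le_trans (mor_nonexpansive f _) _; rewrite -[leRHS](modulus1 R k).
have g1 : `|g (1 : scalar_field R k)| <= 1 :> R.
  by apply: le_trans (mor_nonexpansive g _) _; rewrite -[leRHS](modulus1 R k).
exists (mor_of_bhom f1), (mor_of_bhom g1); split=> v.
  by have := congr1 (fun x : ihom V V => app x v) gf; rewrite hid_self.
by have := congr1 (fun x : ihom W W => app x v) fg; rewrite hid_self.
Qed.

Lemma visomorphic_sym (C : vcat R k fl) (a b : C) :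
  visomorphic a b -> visomorphic b a.
Proof. by move=> [f [g [gf fg]]]; exists g, f. Qed.

End Morphisms.

(** * Banach spaces form the reflective hull of the scalars *)

Section Reflection.
Context (R : realType) (k : scalar_kind) (fl : flavour).
Implicit Types U V W B : obj R k fl.

Lemma banach_orthogonal V W B (h : mor V W) : banach B ->
  vorthogonal h (unit_obj R k fl) -> vorthogonal h B.
Proof.
move=> Bban hR; apply: dense_isometry_orthogonal => //.
  exact: dual_iso_isometric.
exact: dual_iso_dense.
Qed.

Lemma completion_orthogonal V B : banach B -> vorthogonal (completion_mor V) B.
Proof.
move=> Bban; apply: dense_isometry_orthogonal => //.
  exact: completion_isometric.
exact: completion_dense.
Qed.

(** The completion unit of B is orthogonal to the scalars, hence to B by
    hypothesis; it is also orthogonal to the completion, so it is invertible. *)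
Lemma orthogonal_banach B :
  (forall V W (h : mor V W), vorthogonal h (unit_obj R k fl) -> vorthogonal h B) ->
  banach B.
Proof.
move=> Borth; have [||g [hK gK]] := @orthogonal_is_iso R k fl _ _ (completion_mor B).
- by apply: Borth; apply: completion_orthogonal; exact: unit_banach.
- by apply: completion_orthogonal; exact: completion_banach.
apply: (@banach_iso _ _ _ _ _ g); last exact: completion_banach.
by exists (completion_mor B).
Qed.

Definition extend V B (Bban : banach B) : mor (ihom V B) (ihom (completion V) B) :=
  sval (cid (completion_orthogonal V Bban)).

Lemma extendE V B (Bban : banach B) (f : ihom V B) v :
  app (extend V Bban f) (completion_mor V v) = app f v.
Proof.
have [_ K] := svalP (cid (completion_orthogonal V Bban)).
exact: (congr1 (fun x : ihom V B => app x v) (K f)).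
Qed.

Lemma completion_ext V B (f g : ihom (completion V) B) : banach B ->
  (forall v, app f (completion_mor V v) = app g (completion_mor V v)) -> f = g.
Proof.
move=> Bban fg; apply: (dense_range_inj (proj1 Bban) (@completion_dense _ _ _ V)).
exact: bhom_ext.
Qed.

Let Self := self_vcat R k fl.
Let Ban := full_subcat (C := Self) (fun X : obj R k fl => banach X).

Lemma postcomp_unit_le V W : `|postcomp V (bhom_of_mor (completion_mor W))| <= 1 :> R.
Proof.
by apply: le_trans (postcomp_nonexpansive _ _) _; exact: bhom_of_mor_norm.
Qed.

(** The V-functor structure must be a single nonexpansive linear map on hom
    spaces: compose with the unit of W, then extend to the completion of V. *)
Definition completion_map V W :
    mor (ihom V W) (ihom (completion V) (completion W)) :=
  mor_comp (extend V (completion_banach W)) (mor_of_bhom (postcomp_unit_le V W)).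

Lemma completion_mapE V W (f : ihom V W) v :
  app (completion_map V W f) (completion_mor V v) = completion_mor W (app f v).
Proof. exact: extendE. Qed.

Definition completion_ob (V : Self) : Ban :=
  exist (fun X : obj R k fl => banach X) (completion V) (completion_banach V).

Lemma completion_map_comp (a b c : Self) (g : vhom b c) (f : vhom a b) :
  completion_map a c (hcomp g f) =
  @hcomp _ _ _ Ban (completion_ob a) (completion_ob b) (completion_ob c)
    (completion_map b c g) (completion_map a b f).
Proof.
apply: completion_ext => [|v]; first exact: completion_banach.
rewrite completion_mapE.
change (completion_mor c (app g (app f v)) = app (completion_map b c g)
  (app (completion_map a b f) (completion_mor a v))).
by rewrite !completion_mapE.
Qed.

Lemma completion_map_id (a : Self) :
  completion_map a a (hid a) = @hid _ _ _ Ban (completion_ob a).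
Proof.
apply: completion_ext => [|v]; first exact: completion_banach.
rewrite completion_mapE.
by rewrite hid_self; symmetry; exact: hid_self.
Qed.

Definition completion_functor : vfunctor Self Ban :=
  @VFunctor _ _ _ Self Ban completion_ob completion_map
    completion_map_comp completion_map_id.

(** The adjunction is restriction along the completion units. *)
Lemma banach_vreflective :
  vreflective (C := Self) (fun X : obj R k fl => banach X).
Proof.
split; first by move=> V W /visomorphic_is_iso[h /banach_iso]; apply.
exists completion_functor.
exists (fun (c : Self) (d : Ban) => precomp (completion_mor c) (sval d)); split.
- by move=> c d; apply: completion_orthogonal; exact: svalP.
- by move=> c d d' g x; apply: bhom_ext.
- move=> c c' d f x; apply: bhom_ext => v.
  change (app x (app (completion_map c' c f) (completion_mor c' v)) =
    app x (completion_mor c (app f v))).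
  by rewrite completion_mapE.
Qed.

(** The unit rho is the image of the identity of F B under the adjunction, and
    by naturality the adjunction is restriction along rho.  Hence rho is
    orthogonal to every object of the subcategory, in particular to the scalars
    and to F B. *)
Lemma vreflective_contains_banach (P : Self -> Prop) (B : obj R k fl) :
  vreflective P -> P (unit_obj R k fl) -> banach B -> P B.
Proof.
move=> [Prep [F [n [niso nnat _]]]] PR Bban.
pose FB : full_subcat P := F B.
pose rho : ihom B (sval FB) := n B FB (hid FB).
have rho1 : `|rho| <= 1 :> R.
  apply: le_trans (mor_nonexpansive (n B FB) _) _.
  apply: le_trans (mor_nonexpansive (vid FB) _) _.
  by rewrite -[leRHS](modulus1 R k).
pose h := mor_of_bhom rho1.
have horth (D : full_subcat P) : vorthogonal h (sval D).
  apply: is_iso_ext (niso B D) => g.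
  have := nnat B FB D g (hid FB).
  have -> : hcomp g (hid FB) = g by exact: vcompf1.
  by move=> ->; apply: bhom_ext.
have /is_iso_visomorphic/visomorphic_sym BFB : is_iso h.
  apply: orthogonal_is_iso; last exact: horth.
  apply: banach_orthogonal => //.
  exact: (horth (exist P (unit_obj R k fl) PR)).
exact: Prep BFB (svalP FB).
Qed.

End Reflection.

Theorem corollary5p6 (R : realType) (k : scalar_kind) (fl : flavour) :
  is_vreflective_hull (C := self_vcat R k fl)
    (fun X : obj R k fl => X = unit_obj R k fl) (fun X : obj R k fl => banach X)
  /\
  (forall B : obj R k fl,
    [/\ (forall (V W : obj R k fl) (h : mor V W),
           (vorthogonal h (unit_obj R k fl) -> vorthogonal h B) <->
           (is_iso (vdual_mor h) -> is_iso (precomp h B))),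
        (banach B <->
           forall (V W : obj R k fl) (h : mor V W),
             vorthogonal h (unit_obj R k fl) -> vorthogonal h B) &
        (banach B <->
           forall (V W : obj R k fl) (h : mor V W),
             is_iso (vdual_mor h) -> is_iso (precomp h B))]).
Proof.
have ban B : banach B <-> forall (V W : obj R k fl) (h : mor V W),
    vorthogonal h (unit_obj R k fl) -> vorthogonal h B.
  by split=> [Bban V W h|]; [exact: banach_orthogonal | exact: orthogonal_banach].
split; last by move=> B; split=> //; exact: ban.
split; first exact: banach_vreflective.
  by move=> _ ->; exact: unit_banach.
move=> P Pref PR B; apply: vreflective_contains_banach => //; exact: PR.
Qed.
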